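(* Let $d\ge1$. If $\Lambda:\mathbb R^{1,d}\to\mathbb R^{1,d}$ is any element of the Poincaré group, then $\Lambda$ extends to an automorphism (diffeomorphism of manifolds-with-corners) of $\mathbb O$ under which each boundary hypersurface ($\mathrm{Pf},\mathrm{nPf},\mathrm{Sf},\mathrm{nFf},\mathrm{Ff}$) is closed, i.e. mapped to itself.
   Context: $\mathbb R^{1,d}=\mathbb R_t\times\mathbb R^d_{\mathbf x}$, $r=\|\mathbf x\|$, with Minkowski metric $-dt^2+\sum_jdx_j^2$; the Poincaré group is the group of affine maps preserving this metric. $\mathbb M$ is the radial compactification of $\mathbb R^{1+d}$ (closed ball with interior $\mathbb R^{1+d}$ and boundary-defining function (bdf) $(1+t^2+r^2)^{-1/2}$); $\mathrm{cl}_{\mathbb M}$ denotes closure in $\mathbb M$. Null infinity is $\mathscr I=\mathscr I^+\cup\mathscr I^-$, $\mathscr I^\pm=\partial\mathbb M\cap\mathrm{cl}_{\mathbb M}\{\pm t=r\}$. The octagonal compactification $\mathbb O=[\mathbb M;\mathscr I;1/2]$ is the manifold-with-corners obtained from $\mathbb M$ by polar (spherical) blowup of the boundary submanifold $\mathscr I$, after which the smooth structure at the front faces is changed so that the square roots of the original bdfs of the front faces are bdfs. Its interior is $\mathbb R^{1,d}$. Its faces are: $\mathrm{Pf},\mathrm{Ff}$, the lifts of $\partial\mathbb M\cap\mathrm{cl}_{\mathbb M}\{\mp t\ge r\}$ (past: upper sign, future: lower sign); $\mathrm{Sf}$, the lift of $\partial\mathbb M\cap\mathrm{cl}_{\mathbb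 M}\{t^2\le r^2\}$; and the front faces $\mathrm{nPf},\mathrm{nFf}$ of the blowup of $\mathscr I^-,\mathscr I^+$. When $d=1$ each of $\mathrm{nPf},\mathrm{Sf},\mathrm{nFf}$ has two components and is still regarded as a single ''face''.
   Formalization: The claim that each boundary hypersurface is mapped to itself fails for time-reversing elements such as (t,x)→(-t,x); it is asserted for orthochronous elements, while the others still extend to automorphisms but exchange Pf with Ff and nPf with nFf, mapping Sf to itself. *)

(* Defs.v *)
From HB Require Import structures.
From mathcomp Require Import all_boot all_order all_algebra.
From mathcomp Require Import all_classical all_reals all_analysis.

Set Implicit Arguments.
Unset Strict Implicit.
Unset Printing Implicit Defensive.
Import Order.TTheory GRing.Theory Num.Theory numFieldNormedType.Exports.

Local Open Scope classical_set_scope.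
Local Open Scope ring_scope.

(* Every manifold-with-corners below is an embedded submanifold with corners of
  a finite-dimensional real vector space: around each of its points it has a
  chart to [0,oo)^k x R^(n-k) which is the restriction of a smooth ambient map
  and whose inverse is smooth into the ambient space.  Smoothness of a map
  between two such manifolds is therefore local smooth extendability. *)

Section Smooth.
Variables (R : realType) (V W : normedModType R).

Fixpoint Ck (k : nat) (U : set V) (f : V -> W) : Prop :=
  if k is k'.+1
  then (forall x, U x -> differentiable f x) /\
       (forall v, Ck k' U ('D_v f))
  else forall x, U x -> {for x, continuous f}.

Definition smooth_on (X : set V) (f : V -> W) : Prop :=
  forall x, X x -> exists (U : set V) (F : V -> W),
    [/\ open U, U x, (forall k, Ck k U F) &
        forall y, X y -> U y -> F y = f y].

End Smooth.

Definition diffeomorphism (R : realType) (V W : normedModType R)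
    (X : set V) (Y : set W) (f : V -> W) : Prop :=
  exists g : W -> V,
    [/\ (forall x, X x -> Y (f x)) /\ (forall y, Y y -> X (g y)),
        forall x, X x -> g (f x) = x,
        forall y, Y y -> f (g y) = y,
        smooth_on X f &
        smooth_on Y g].

Section Minkowski.
Variables (R : realType) (d : nat).

(* (t, x); the canonical norm of this normed module is a sup norm *)
Definition spacetime : Type := (R * 'rV[R]_d)%type.
HB.instance Definition _ := NormedModule.on spacetime.

Definition enorm (x : 'rV[R]_d) : R := Num.sqrt (\sum_(i < d) x 0 i ^+ 2).

Definition minkowski (z w : spacetime) : R :=
  - (z.1 * w.1) + \sum_(i < d) z.2 0 i * w.2 0 i.

Definition poincare (Lam : spacetime -> spacetime) : Prop :=
  exists (L : {linear spacetime -> spacetime}) (v : spacetime),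
    (forall z, Lam z = L z + v) /\
    (forall z w, minkowski (L z) (L w) = minkowski z w).

(* the linear part of Lam maps the future unit vector d/dt to a vector with
   positive time component *)
Definition orthochronous (Lam : spacetime -> spacetime) : Prop :=
  0 < (Lam (1, 0)).1 - (Lam 0).1.

(* The smooth structure for which (1+t^2+r^2)^(-1/2) is a boundary-defining
  function is that of the closed upper hemisphere
    { (rho, (tau, xi)) | rho >= 0, rho^2 + tau^2 + |xi|^2 = 1 }
  into which spacetime is embedded by z |-> (1, z) / sqrt (1 + |z|^2).
  (The closed ball { |y| <= 1 } with its standard smooth structure and
  y = z / sqrt (1 + |z|^2) would make 1 + t^2 + r^2 the reciprocal of a
  boundary-defining function instead.) *)

Definition bdf (z : spacetime) : R :=
  (Num.sqrt (1 + z.1 ^+ 2 + enorm z.2 ^+ 2))^-1.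

Definition ambientM : Type := (R * spacetime)%type.
HB.instance Definition _ := NormedModule.on ambientM.

Definition MM : set ambientM :=
  [set p | 0 <= p.1 /\ p.1 ^+ 2 + p.2.1 ^+ 2 + enorm p.2.2 ^+ 2 = 1].

Definition toM (z : spacetime) : ambientM := (bdf z, bdf z *: z).

Definition bdM : set ambientM := MM `&` [set p | p.1 = 0].

Definition clM (A : set spacetime) : set ambientM := MM `&` closure (toM @` A).

(* eps = 1 for the future, eps = -1 for the past *)
Definition scri_ (eps : R) : set ambientM :=
  bdM `&` clM [set z | eps * z.1 = enorm z.2].

Definition scri : set ambientM := scri_ 1 `|` scri_ (-1).

Definition causal_bd (eps : R) : set ambientM :=
  bdM `&` clM [set z | eps * z.1 >= enorm z.2].

Definition spacelike_bd : set ambientM :=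
  bdM `&` clM [set z | z.1 ^+ 2 <= enorm z.2 ^+ 2].

(* Polar blowup [X; S] of S = { x = 0, y = 0 } in a manifold-with-corners X,
  where x is a boundary-defining function and (x, y) has independent
  differentials along S.  The inward-pointing spherical normal bundle of S is
  then S x { theta in S^1 | theta.1 >= 0 }.  [X; S] consists of X minus S and
  of this bundle (the front face), with the smooth structure generated by the
  polar coordinates
    lambda = |(x, y)|,   theta = (x, y) / lambda
  and the lifts of the smooth functions on X.  A point of [X; S] is encoded as
  (p, (lambda, theta)), p being its image under the blowdown map.  Near the
  front face, lambda, theta and coordinates of X tangential to S form a chart,
  in which p is smooth as (x, y) = lambda * theta is. *)

Definition ambientO : Type := (ambientM * (R * (R * R)))%type.
HB.instance Definition _ := NormedModule.on ambientO.

Definition polar_blowup (X : set ambientM) (x y : ambientM -> R) :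
    set ambientO :=
  [set q | let: (p, (lam, th)) := q in
     [/\ X p, 0 <= lam, 0 <= th.1 /\ th.1 ^+ 2 + th.2 ^+ 2 = 1,
         x p = lam * th.1 & y p = lam * th.2]].

(* lambda is a boundary-defining function of the front face of a polar blowup.
   The new smooth functions near the front face are the smooth functions of
   sigma = sqrt lambda and of the other old coordinates. *)
Definition sqrt_front (B : set ambientO) : set ambientO :=
  [set q | let: (p, (sigma, th)) := q in
     0 <= sigma /\ B (p, (sigma ^+ 2, th))].

(* by scriE below, scri is the common zero set in MM of rho and cone *)
Definition rho (p : ambientM) : R := p.1.
Definition cone (p : ambientM) : R := p.2.1 ^+ 2 - enorm p.2.2 ^+ 2.

Definition OO : set ambientO := sqrt_front (polar_blowup MM rho cone).

Definition blowdown (q : ambientO) : ambientM := q.1.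

Definition toO (z : spacetime) : ambientO :=
  let p := toM z in
  let lam := Num.sqrt (rho p ^+ 2 + cone p ^+ 2) in
  (p, (Num.sqrt lam, (rho p / lam, cone p / lam))).

Definition lift (F : set ambientM) : set ambientO :=
  OO `&` closure (OO `&` blowdown @^-1` (F `\` scri)).

Definition Pf : set ambientO := lift (causal_bd (-1)).
Definition Sf : set ambientO := lift spacelike_bd.
Definition Ff : set ambientO := lift (causal_bd 1).
Definition nPf : set ambientO := OO `&` blowdown @^-1` (scri_ (-1)).
Definition nFf : set ambientO := OO `&` blowdown @^-1` (scri_ 1).

End Minkowski.

Arguments MM {R d}.
Arguments bdM {R d}.
Arguments scri_ {R d} eps.
Arguments scri {R d}.
Arguments causal_bd {R d} eps.
Arguments spacelike_bd {R d}.
Arguments OO {R d}.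
Arguments Pf {R d}.
Arguments nPf {R d}.
Arguments Sf {R d}.
Arguments nFf {R d}.
Arguments Ff {R d}.

Section ScriE.
Variables (R : realType) (d : nat).

Lemma enorm_ge0 (x : 'rV[R]_d) : 0 <= enorm x.
Proof. exact: sqrtr_ge0. Qed.

Lemma enormZ (c : R) (x : 'rV[R]_d) : enorm (c *: x) = `|c| * enorm x.
Proof.
rewrite /enorm -sqrtr_sqr -sqrtrM ?sqr_ge0// mulr_sumr.
by congr Num.sqrt; apply: eq_bigr => i _; rewrite mxE exprMn.
Qed.

Lemma continuous_enorm : continuous (@enorm R d).
Proof.
move=> x; apply: (@continuous_comp _ _ _
  (fun x : 'rV[R]_d => \sum_(i < d) x 0 i ^+ 2) Num.sqrt).
  apply: (@continuous_big _ _ +%R 0 xpredT _ _ _ (fun i (y : 'rV[R]_d) => y 0 i ^+ 2)) => [|i _].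
    exact: add_continuous.
  move=> y.
  apply: (@continuous_comp _ _ _ (fun y : 'rV[R]_d => y 0 i) (fun a : R => a ^+ 2)).
    exact: coord_continuous.
  exact: exprn_continuous.
exact: sqrt_continuous.
Qed.

Lemma bdf_gt0 (z : spacetime R d) : 0 < bdf z.
Proof.
rewrite invr_gt0 sqrtr_gt0 -addrA ltr_wpDr ?ltr01//.
by rewrite addr_ge0 ?sqr_ge0.
Qed.

Lemma toM_MM (z : spacetime R d) : MM (toM z).
Proof.
split; first exact/ltW/bdf_gt0.
rewrite /= enormZ !exprMn real_normK ?num_real// -[X in X + _ + _]mulr1.
have h : 0 < 1 + z.1 ^+ 2 + enorm z.2 ^+ 2.
  by rewrite -addrA ltr_wpDr ?ltr01// addr_ge0 ?sqr_ge0.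
rewrite -!mulrDr /bdf exprVn sqr_sqrtr ?ltW// mulVf//.
by rewrite gt_eqF.
Qed.

Lemma toO_OO (z : spacetime R d) : OO (toO z).
Proof.
rewrite /OO /toO; set p := toM z; set lam := Num.sqrt (rho p ^+ 2 + _).
have lam2 : lam ^+ 2 = rho p ^+ 2 + cone p ^+ 2.
  by rewrite sqr_sqrtr// addr_ge0 ?sqr_ge0.
have lam_gt0 : 0 < lam.
  rewrite sqrtr_gt0 ltr_wpDr ?sqr_ge0// exprn_gt0//; exact: bdf_gt0.
split; first exact: sqrtr_ge0.
rewrite sqr_sqrtr ?(ltW lam_gt0)//; split => //=.
- exact: toM_MM.
- exact: ltW.
- split; first by rewrite divr_ge0 ?(ltW lam_gt0)//; exact/ltW/bdf_gt0.
  by rewrite !expr_div_n -mulrDl -lam2 mulfV// gt_eqF// exprn_gt0.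
- by rewrite mulrCA mulfV ?mulr1// gt_eqF.
- by rewrite mulrCA mulfV ?mulr1// gt_eqF.
Qed.

Lemma scri_E (eps : R) : scri_ eps =
  MM `&` [set p : ambientM R d | rho p = 0 /\ eps * p.2.1 = enorm p.2.2].
Proof.
apply/seteqP; split => [p [[Mp p0] [_ clp]]|[r [t x]] [Mp [/= p0 px]]].
  split=> //; split=> //.
  suff : closed [set p : ambientM R d | eps * p.2.1 - enorm p.2.2 = 0].
    move=> /closure_id cE; apply/subr0_eq.
    change ([set p : ambientM R d | eps * p.2.1 - enorm p.2.2 = 0] p).
    rewrite cE; apply: closureS clp => _ [z /= zE <-] /=.
    by rewrite enormZ gtr0_norm ?bdf_gt0// -zE mulrCA subrr.
  have -> : [set p : ambientM R d | eps * p.2.1 - enorm p.2.2 = 0] =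
      (fun p : ambientM R d => eps * p.2.1 - enorm p.2.2) @^-1` [set 0 : R].
    by [].
  suff cf : continuous (fun p : ambientM R d => eps * p.2.1 - enorm p.2.2).
    by move/continuous_closedP: cf; apply; exact: closed_eq.
  move=> q; apply: cvgB.
    apply: cvgMl_tmp; apply: (@continuous_comp _ _ _ snd fst).
      exact: cvg_snd.
    exact: cvg_fst.
  apply: (@continuous_comp _ _ _ (fun q : ambientM R d => q.2.2) (@enorm R d)).
    by apply: (@continuous_comp _ _ _ snd snd); exact: cvg_snd.
  exact: continuous_enorm.
split; first by [].
split=> //.
have {}p0 : r = 0 by [].
have n1 : t ^+ 2 + enorm x ^+ 2 = 1.
  by case: Mp => _ /=; rewrite p0 expr0n add0r.
pose s (n : nat) : R := (Num.sqrt (1 + harmonic n ^+ 2))^-1.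
pose u (n : nat) : ambientM R d := (harmonic n * s n, s n *: (t, x)).
have cs : s n @[n --> \oo] --> (1 : R).
  rewrite -[X in _ --> X]invr1; apply: cvgV; first exact: oner_neq0.
  suff c1 : 1 + harmonic n ^+ 2 @[n --> \oo] --> (1 : R).
    rewrite -[X in _ --> X]sqrtr1.
    by apply: (cvg_comp _ _ c1); exact: sqrt_continuous.
  rewrite -[X in _ --> X]addr0; apply: cvgD; first exact: cvg_cst.
  rewrite -[X in _ --> X](mul0r (0 : R)).
  by apply: (@cvgM _ _ _ _ harmonic harmonic); exact: cvg_harmonic.
have cu : u @ \oo --> ((r, (t, x)) : ambientM R d).
  have cr : harmonic n * s n @[n --> \oo] --> r.
    rewrite p0 -[X in _ --> X](mul0r (1 : R)).
    by apply: (@cvgM _ _ _ _ harmonic s) => //; exact: cvg_harmonic.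
  have cz : s n *: ((t, x) : spacetime R d) @[n --> \oo] -->
      ((t, x) : spacetime R d).
    rewrite -[X in _ --> X](@scale1r R (spacetime R d)).
    exact: cvgZr_tmp.
  exact: cvg_pair cr cz.
apply: (closed_cvg _ (@closed_closure _ _) _ _ cu); apply: nearW => n.
apply: subset_closure; exists ((harmonic n)^-1 *: ((t, x) : spacetime R d)) => /=.
  by rewrite enormZ gtr0_norm ?invr_gt0 ?harmonic_gt0// -px mulrCA.
have h0 : 0 < harmonic n :> R := harmonic_gt0 n.
have hb : bdf ((harmonic n)^-1 *: ((t, x) : spacetime R d)) = harmonic n * s n.
  rewrite /bdf /= enormZ !exprMn real_normK ?num_real// -addrA -mulrDr n1 mulr1.
  rewrite /s -[X in X * _]invrK -invfM; congr (_^-1).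
  rewrite -[X in X * Num.sqrt _]gtr0_norm ?invr_gt0// -sqrtr_sqr -sqrtrM ?sqr_ge0//.
  by rewrite mulrDr mulr1 addrC -exprMn mulVf ?expr1n ?gt_eqF.
rewrite /toM hb scalerA /u; congr (_, _ *: _).
by rewrite mulrAC mulfV ?mul1r ?gt_eqF.
Qed.

Lemma scriE :
  scri = MM `&` [set p : ambientM R d | rho p = 0 /\ cone p = 0].
Proof.
rewrite /scri !scri_E -setIUr; congr (_ `&` _).
apply/seteqP; split=> p /=.
  by rewrite /cone => -[] [-> <-]; rewrite exprMn ?sqrrN expr1n mul1r subrr.
move=> [-> /subr0_eq/eqP]; rewrite eqf_sqr => /orP[]/eqP e; [left|right].
  by rewrite mul1r.
by rewrite e mulN1r opprK.
Qed.

End ScriE.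

(* Main.v *)
Require Import Defs.
From HB Require Import structures.
From mathcomp Require Import all_boot all_order all_algebra.
From mathcomp Require Import all_classical all_reals all_analysis.
From mathcomp Require Import ring lra.

(** A Poincare transformation [z |-> L z + v] acts on homogeneous coordinates by
    [(rho, y) |-> (rho, L y + rho v)].  Followed by normalization, this extends
    the transformation to the radial compactification [MM], and the inverse
    transformation gives the inverse map.  As [L] preserves the Minkowski form
    [eta] and [cone (rho, y) = - eta y y], the action sends [cone] to
      [cone - 2 rho eta (L y) v - rho^2 eta v v],
    so that the ideal generated by [rho] and [cone], hence null infinity, is
    preserved and the map lifts to the blowup.  Write [rho = sigma^2 a] and
    [cone = sigma^2 b] on [OO], and let [N] be the norm of [(rho, L y + rho v)].
    Then [rho] and [cone] of the image are [sigma^2] times [theta1 = a / N] and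
    [theta2 = (b - 2 a eta (L y) v - sigma^2 a^2 eta v v) / N^2].  These do not
    vanish simultaneously, because [a = 0] forces [b = 1] or [b = -1].
    Normalizing them yields the new direction [theta] and, with
    [D = |(theta1, theta2)| > 0], the new [sigma] equal to [sqrt D * sigma].
    This formula, [actO], is built from polynomials, inverses and square roots
    of positive functions, hence smooth ([smooth_actO]); the formula of the
    inverse transformation inverts it ([actOK]), and it agrees with the
    transformation in the interior since a point of [OO] with [rho <> 0] is
    determined by its blowdown ([actO_toO]).

    As for the faces, the boundary at infinity of a closed cone in spacetime is
    its set of rays ([bd_clM_cone]), and on [rho = 0] the map [actM] of [MM] is
    [L] up to a positive factor.  A Lorentz map preserves the spacelike cone, and
    it preserves or exchanges the two causal cones according to the sign of the
    time component of [L (1, 0)] ([lorentz_future]).  This passes to the lifts by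
    continuity, and to equalities by the same argument for the inverse. *)

Set Implicit Arguments.
Unset Strict Implicit.
Unset Printing Implicit Defensive.
Import Order.TTheory GRing.Theory Num.Theory numFieldNormedType.Exports.
Local Open Scope classical_set_scope.
Local Open Scope ring_scope.

(** * Calculus of class C^k maps *)

Section Calculus.
Context {R : realType} {V : normedModType R}.
Implicit Types (U : set V) (k : nat) (f g : V -> R).

(** Differentiability at a point only depends on the germ: a difference which
    vanishes near the point is differentiable there, with differential 0. *)
Lemma near_eq_differentiable (W : normedModType R) (f g : V -> W) (x : V) :
  (\near x, f x = g x) -> differentiable f x -> differentiable g x.
Proof.
move=> fg df; have -> : g = f + (g - f) by rewrite addrC subrK.
apply: differentiableD => //.
set h := g - f; have h0 : \near x, h x = 0.
  near=> y; have E : f y = g y by near: y.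
  by rewrite /h !fctE E subrr.
have hx : h x = 0 := nbhs_singleton h0.
have c0 : continuous (\0 : {linear V -> W}) by exact: cst_continuous.
have e0 : h \o shift x = cst (h x) + (\0 : {linear V -> W}) +o_ 0 id.
  apply/eqaddoP => _/posnumP[e].
  have /= : \forall y \near 0, (h \o shift x) y = 0.
    by move: h0; rewrite (near_shift 0) subr0.
  apply: filterS => y /= hy; rewrite !fctE /= hy hx addr0 subrr normr0.
  by rewrite mulr_ge0.
by apply/diff_locallyP; rewrite (diff_unique c0 e0).
Unshelve. all: by end_near. Qed.

Lemma open_near U (P : V -> Prop) x : open U -> U x -> (forall y, U y -> P y) ->
  \forall y \near x, P y.
Proof. by move=> oU Ux UP; apply: filterS (open_nbhs_nbhs (conj oU Ux)). Qed.

(** The functions ['D_v f] that [Ck] iterates are unspecified off [U], so the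
    closure properties below identify them on [U] only. *)
Lemma Ck_ext (W : normedModType R) k U (f g : V -> W) : open U ->
  (forall x, U x -> f x = g x) -> Ck k U f -> Ck k U g.
Proof.
move=> oU; elim: k f g => [|k IH] f g fg.
  move=> cf x Ux; have nfg := open_near oU Ux fg.
  rewrite /prop_for /continuous_at -(fg x Ux).
  by apply: cvg_trans (cf x Ux); exact: near_eq_cvg.
move=> -[df Df]; split=> [x Ux|v].
  exact: near_eq_differentiable (open_near oU Ux fg) (df x Ux).
apply: IH (Df v) => x Ux; apply: near_eq_derive; exact: (open_near oU Ux).
Qed.

Lemma CkS (W : normedModType R) k U (f : V -> W) : Ck k.+1 U f -> Ck k U f.
Proof.
elim: k f => [|k IH] f [df Df]; first by move=> x /df/differentiable_continuous.
by split=> // v; exact: IH.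
Qed.

Lemma Ck_cst (W : normedModType R) k U (w : W) : Ck k U (cst w).
Proof.
elim: k w => [|k IH] w; first by move=> x _; exact: cst_continuous.
split=> [x _|v]; first exact: differentiable_cst.
rewrite (_ : 'D_v (cst w) = cst 0); first exact: IH.
by apply/funext => x; rewrite derive_cst.
Qed.

Lemma Ck_id k U : Ck k U (id : V -> V).
Proof.
case: k => [|k]; first by move=> x _; exact: cvg_id.
split=> [x _|v]; first exact: ex_diff.
by rewrite (_ : 'D_v id = cst v); [exact: Ck_cst | apply/funext => x; rewrite derive_id].
Qed.

Lemma Ck_linear_comp (W W' : normedModType R) k U (f : V -> W) (l : W -> W') :
  open U -> linear l -> continuous l -> Ck k U f -> Ck k U (fun x => l (f x)).
Proof.
move=> oU ll cl; pose l' : {linear W -> W'} :=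
  HB.pack l (GRing.isLinear.Build _ _ _ _ _ ll).
have dl x : differentiable l x by exact: (@linear_differentiable _ _ _ l' x cl).
elim: k f => [|k IH] f.
  by move=> cf x Ux; apply: continuous_comp; [exact: cf | exact: cl].
move=> [df Df]; split=> [x Ux|v].
  by apply: differentiable_comp; [exact: df | exact: dl].
apply: Ck_ext (IH _ (Df v)) => // x Ux; have dfx := df x Ux.
rewrite (deriveE v (differentiable_comp dfx (dl _))) diff_comp//= deriveE//.
by rewrite (diff_lin (f x) (f := l') cl).
Qed.

Lemma CkD (W : normedModType R) k U (f g : V -> W) : open U ->
  Ck k U f -> Ck k U g -> Ck k U (fun x => f x + g x).
Proof.
move=> oU; elim: k f g => [|k IH] f g.
  by move=> cf cg x Ux; apply: cvgD; [exact: cf | exact: cg].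
move=> [df Df] [dg Dg]; split=> [x Ux|v].
  by apply: differentiableD; [exact: df | exact: dg].
apply: Ck_ext (IH _ _ (Df v) (Dg v)) => // x Ux.
by rewrite deriveD//; apply: diff_derivable; [exact: df | exact: dg].
Qed.

Lemma Ck_sum (W : normedModType R) k U n (f : 'I_n -> V -> W) : open U ->
  (forall i, Ck k U (f i)) -> Ck k U (fun x => \sum_(i < n) f i x).
Proof.
move=> oU; elim: n f => [|n IH] f Cf.
  apply: Ck_ext (Ck_cst k U 0) => // x _; by rewrite big_ord0.
apply: Ck_ext (CkD oU (IH (fun i => f (widen_ord (leqnSn n) i)) _) (Cf ord_max)) => //.
by move=> x _; rewrite big_ord_recr.
Qed.

Lemma CkM k U f g : open U -> Ck k U f -> Ck k U g -> Ck k U (fun x => f x * g x).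
Proof.
move=> oU; elim: k f g => [|k IH] f g.
  by move=> cf cg x Ux; apply: cvgM; [exact: cf | exact: cg].
move=> Cf Cg; have [[df Df] [dg Dg]] := (Cf, Cg); split=> [x Ux|v].
  by apply: differentiableM; [exact: df | exact: dg].
apply: Ck_ext (CkD oU (IH _ _ (CkS Cf) (Dg v)) (IH _ _ (CkS Cg) (Df v))) => //.
by move=> x Ux; rewrite deriveM//; apply: diff_derivable; [exact: df | exact: dg].
Qed.

Lemma CkZl (W : normedModType R) k U f (w : W) : open U ->
  Ck k U f -> Ck k U (fun x => f x *: w).
Proof.
move=> oU; elim: k f => [|k IH] f.
  by move=> cf x Ux; apply: cvgZr_tmp; exact: cf.
move=> [df Df]; split=> [x Ux|v]; first by apply: differentiableZl; exact: df.
apply: Ck_ext (IH _ (Df v)) => // x Ux.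
have dfx := df x Ux.
by rewrite (deriveE v dfx) (deriveE v (differentiableZl w dfx)) diffZl.
Qed.

Lemma CkN k U f : open U -> Ck k U f -> Ck k U (fun x => - f x).
Proof.
move=> oU Cf; apply: Ck_ext (CkM oU (@Ck_cst R k U (-1)) Cf) => // x _.
by rewrite mulN1r.
Qed.

Lemma CkV k U f : open U -> (forall x, U x -> f x != 0) ->
  Ck k U f -> Ck k U (fun x => (f x)^-1).
Proof.
move=> oU f0; elim: k => [|k IH].
  by move=> cf x Ux; apply: cvgV; [exact: f0 | exact: cf].
move=> Cf; have [df Df] := Cf; split=> [x Ux|v].
  by apply: differentiableV; [exact: df | exact: f0].
have C1 := IH (CkS Cf).
apply: Ck_ext (CkN oU (CkM oU (CkM oU C1 C1) (Df v))) => // x Ux.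
rewrite deriveV; [|exact: f0|exact/diff_derivable/df].
by rewrite expr2 invfM scaleNr.
Qed.

Lemma Ck_sqrt k U f : open U -> (forall x, U x -> 0 < f x) ->
  Ck k U f -> Ck k U (fun x => Num.sqrt (f x)).
Proof.
move=> oU f0; elim: k => [|k IH].
  move=> cf x Ux; apply: (@continuous_comp _ _ _ f Num.sqrt); first exact: cf.
  exact: sqrt_continuous.
have dsqrt x : U x -> differentiable (@Num.sqrt R) (f x).
  move=> Ux; apply/derivable1_diffP.
  by case: (is_derive1_sqrt (f0 x Ux)).
move=> Cf; have [df Df] := Cf; split=> [x Ux|v].
  by apply: differentiable_comp; [exact: df | exact: dsqrt].
have Cs := IH (CkS Cf).
have s0 x : U x -> 2 * Num.sqrt (f x) != 0.
  by move=> Ux; rewrite mulf_neq0// gt_eqF// sqrtr_gt0 f0.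
apply: Ck_ext (CkM oU (Df v) (CkV oU s0 (CkM oU (@Ck_cst R k U 2) Cs))) => // x Ux.
rewrite (deriveE v (differentiable_comp (df x Ux) (dsqrt x Ux))).
rewrite (diff_comp (df x Ux) (dsqrt x Ux)) /= deriv1E; last first.
  exact/derivable1_diffP/dsqrt.
by rewrite derive1E derive_sqrt ?f0// (deriveE v (df x Ux)).
Qed.

Lemma Ck_pair (W W' : normedModType R) k U (f : V -> W) (g : V -> W') :
  open U ->
  Ck k U f -> Ck k U g -> Ck k U (fun x => (f x, g x)).
Proof.
move=> oU; elim: k f g => [|k IH] f g.
  by move=> cf cg x Ux; apply: cvg_pair; [exact: cf | exact: cg].
move=> [df Df] [dg Dg]; split=> [x Ux|v].
  by apply: differentiable_pair; [exact: df | exact: dg].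
apply: Ck_ext (IH _ _ (Df v) (Dg v)) => // x Ux.
have [dfx dgx] := (df x Ux, dg x Ux).
by rewrite !deriveE ?diff_pair//; exact: differentiable_pair.
Qed.

End Calculus.

Section Components.
Context {R : realType} {V : normedModType R}.
Context {k : nat} {U : set V} (oU : open U).

Lemma Ck_fst (W W' : normedModType R) (f : V -> (W * W')%type) :
  Ck k U f -> Ck k U (fun x => (f x).1).
Proof. by apply: Ck_linear_comp => // x; exact: cvg_fst. Qed.

Lemma Ck_snd (W W' : normedModType R) (f : V -> (W * W')%type) :
  Ck k U f -> Ck k U (fun x => (f x).2).
Proof. by apply: Ck_linear_comp => // x; exact: cvg_snd. Qed.

Lemma Ck_coord (n : nat) (f : V -> 'rV[R]_n) i :
  Ck k U f -> Ck k U (fun x => f x 0 i).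
Proof.
apply: (Ck_linear_comp (l := fun M : 'rV[R]_n => M 0 i)) => //.
  by move=> c x y; rewrite !mxE.
exact: coord_continuous.
Qed.

Lemma Ck_sqr (f : V -> R) : Ck k U f -> Ck k U (fun x => f x ^+ 2).
Proof. by move=> Cf; exact: (CkM oU Cf Cf). Qed.

End Components.

(** * Lorentz transformations *)

Section Lorentz.
Context {R : realType} {d : nat}.
Local Notation ST := (spacetime R d).
Local Notation eta := (@Defs.minkowski R d).
Implicit Types (z w v : ST) (c : R).

Lemma minkowskiC z w : eta z w = eta w z.
Proof.
by rewrite /Defs.minkowski mulrC; congr (_ + _); apply: eq_bigr => i _; rewrite mulrC.
Qed.

Lemma minkowskiDl z w v : eta (z + w) v = eta z v + eta w v.
Proof.
rewrite /Defs.minkowski mulrDl opprD addrACA -big_split /=; congr (_ + _).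
by apply: eq_bigr => i _; rewrite mxE mulrDl.
Qed.

Lemma minkowskiZl c z w : eta (c *: z) w = c * eta z w.
Proof.
rewrite /Defs.minkowski mulrDr mulr_sumr mulrN mulrA; congr (_ + _).
by apply: eq_bigr => i _; rewrite mxE mulrA.
Qed.

Lemma minkowskiDr z w v : eta v (z + w) = eta v z + eta v w.
Proof. by rewrite !(minkowskiC v) minkowskiDl. Qed.

Lemma minkowskiZr c z w : eta w (c *: z) = c * eta w z.
Proof. by rewrite !(minkowskiC w) minkowskiZl. Qed.

Lemma minkowski_sumr (n : nat) w (F : 'I_n -> ST) :
  eta w (\sum_(i < n) F i) = \sum_(i < n) eta w (F i).
Proof.
apply: (big_morph (eta w)); first by move=> *; exact: minkowskiDr.
by rewrite -[0 in LHS](scale0r (0 : ST)) minkowskiZr mul0r.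
Qed.

Definition time_unit : ST := (1, 0).
Definition space_unit (i : 'I_d) : ST := (0, delta_mx 0 i).

Lemma minkowski_time w : eta w time_unit = - w.1.
Proof. by rewrite /Defs.minkowski /= mulr1 big1 ?addr0// => i _; rewrite mxE mulr0. Qed.

Lemma minkowski_space w i : eta w (space_unit i) = w.2 0 i.
Proof.
rewrite /Defs.minkowski /= mulr0 oppr0 add0r (bigD1 i)//= mxE !eqxx mulr1.
by rewrite big1 ?addr0// => j ji; rewrite mxE eqxx (negbTE ji) mulr0.
Qed.

Lemma fst_sum (V W : nmodType) (n : nat) (F : 'I_n -> V * W) :
  (\sum_(i < n) F i).1 = \sum_(i < n) (F i).1.
Proof. exact: (big_morph fst). Qed.

Lemma snd_sum (V W : nmodType) (n : nat) (F : 'I_n -> V * W) :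
  (\sum_(i < n) F i).2 = \sum_(i < n) (F i).2.
Proof. exact: (big_morph snd). Qed.

Lemma spacetime_eq z w : z.1 = w.1 -> z.2 = w.2 -> z = w.
Proof. by case: z w => [t x] [t' x'] /= -> ->. Qed.

Lemma spacetime_basis z :
  z = z.1 *: time_unit + \sum_(i < d) z.2 0 i *: space_unit i.
Proof.
apply: spacetime_eq => /=.
  by rewrite fst_sum big1 ?addr0 => [|i _] /=; rewrite [_ *: _]mulr1 || rewrite scaler0.
rewrite snd_sum scaler0 add0r [LHS]row_sum_delta.
by apply: eq_bigr => i _.
Qed.

Lemma linear_spacetime (f : {linear ST -> ST}) z :
  f z = z.1 *: f time_unit + \sum_(i < d) z.2 0 i *: f (space_unit i).
Proof.
rewrite {1}(spacetime_basis z) linearD linearZ linear_sum /=.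
by congr (_ + _); apply: eq_bigr => i _; rewrite linearZ.
Qed.

Lemma minkowski_inj z w : (forall v, eta z v = eta w v) -> z = w.
Proof.
move=> zw; apply: spacetime_eq.
  by apply: oppr_inj; rewrite -!minkowski_time.
by apply/rowP => i; rewrite -!minkowski_space.
Qed.

(** The adjoint for the Minkowski form, given by its components in the basis
    [time_unit], [space_unit i]; it is the inverse of a Lorentz map. *)
Definition adjoint (f : ST -> ST) (w : ST) : ST :=
  (- eta w (f time_unit), \row_i eta w (f (space_unit i))).

Fact adjoint_linear (f : ST -> ST) : linear (adjoint f).
Proof.
move=> c z w; rewrite /adjoint; apply: spacetime_eq => /=.
  by rewrite minkowskiDl minkowskiZl [c *: _]mulrN opprD.
by apply/rowP => i; rewrite !mxE minkowskiDl minkowskiZl.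
Qed.

HB.instance Definition _ (f : ST -> ST) :=
  GRing.isLinear.Build R ST ST _ (adjoint f) (adjoint_linear f).

Lemma minkowski_adjoint (f : {linear ST -> ST}) z w :
  eta (adjoint f w) z = eta w (f z).
Proof.
rewrite (linear_spacetime f) minkowskiDr minkowskiZr minkowski_sumr {1}/Defs.minkowski /=.
rewrite mulNr opprK mulrC; congr (_ + _).
by apply: eq_bigr => i _; rewrite minkowskiZr mxE mulrC.
Qed.

(** Preservation of the Minkowski form; linearity is required separately. *)
Definition lorentz (f : ST -> ST) := forall z w, eta (f z) (f w) = eta z w.

Lemma adjointK (f : {linear ST -> ST}) : lorentz f -> cancel f (adjoint f).
Proof. by move=> Lf z; apply: minkowski_inj => v; rewrite minkowski_adjoint Lf. Qed.

(** Spacetime vectors as row vectors, time component first. *)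
Definition st_row (z : ST) : 'rV[R]_(1 + d) := row_mx (\row_(_ < 1) z.1) z.2.
Definition row_st (u : 'rV[R]_(1 + d)) : ST := (lsubmx u 0 0, rsubmx u).

Lemma st_rowK : cancel st_row row_st.
Proof. by case=> t x; rewrite /row_st row_mxKl row_mxKr mxE. Qed.

Lemma row_stK : cancel row_st st_row.
Proof.
move=> u; rewrite /st_row -[RHS]hsubmxK; congr row_mx.
by apply/matrixP => i j; rewrite !ord1 [LHS]mxE.
Qed.

Lemma st_row_conj_linear (f : {linear ST -> ST}) :
  linear (st_row \o f \o row_st).
Proof.
move=> c u w /=; have -> : row_st (c *: u + w) = c *: row_st u + row_st w.
  by rewrite /row_st !linearP /= !mxE.
rewrite linearP /st_row /= scale_row_mx add_row_mx; congr row_mx.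
by apply/rowP => i; rewrite !mxE.
Qed.

(** A left inverse of a linear endomorphism of spacetime is a right inverse:
    this is the corresponding fact on square matrices. *)
Lemma cancel_linearC (f g : {linear ST -> ST}) : cancel f g -> cancel g f.
Proof.
move=> fg.
pose F : {linear 'rV[R]_(1 + d) -> 'rV[R]_(1 + d)} :=
  HB.pack (st_row \o f \o row_st) (GRing.isLinear.Build _ _ _ _ _ (st_row_conj_linear f)).
pose G : {linear 'rV[R]_(1 + d) -> 'rV[R]_(1 + d)} :=
  HB.pack (st_row \o g \o row_st) (GRing.isLinear.Build _ _ _ _ _ (st_row_conj_linear g)).
have AB : lin1_mx F *m lin1_mx G = 1%:M.
  apply/row_matrixP => i; rewrite !rowE mulmx1 mulmxA !mul_rV_lin1 /=.
  by rewrite st_rowK fg row_stK.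
move=> z; apply: (can_inj st_rowK).
have := congr1 (mulmx (st_row z)) (mulmx1C AB).
by rewrite mulmx1 mulmxA !mul_rV_lin1 /= !st_rowK.
Qed.

Lemma adjointVK (f : {linear ST -> ST}) : lorentz f -> cancel (adjoint f) f.
Proof. by move=> Lf; apply: cancel_linearC; exact: adjointK. Qed.

Lemma lorentz_adjoint (f : {linear ST -> ST}) : lorentz f -> lorentz (adjoint f).
Proof. by move=> Lf z w; rewrite minkowski_adjoint adjointVK. Qed.

Lemma minkowski_diag z : eta z z = - z.1 ^+ 2 + enorm z.2 ^+ 2.
Proof.
rewrite /Defs.minkowski expr2; congr (_ + _).
by rewrite sqr_sqrtr ?sumr_ge0// => i _; exact: sqr_ge0.
Qed.

Lemma enorm_sq (x : 'rV[R]_d) : enorm x ^+ 2 = \sum_(i < d) x 0 i ^+ 2.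
Proof. by rewrite sqr_sqrtr ?sumr_ge0// => i _; exact: sqr_ge0. Qed.

Lemma enorm_eq0 (x : 'rV[R]_d) : enorm x = 0 -> x = 0.
Proof.
move=> x0; have : enorm x ^+ 2 = 0 by rewrite x0 expr0n.
rewrite enorm_sq => /eqP; rewrite psumr_eq0; last by move=> *; exact: sqr_ge0.
move=> /allP xi; apply/rowP => i; rewrite mxE.
by have := xi i (mem_index_enum _); rewrite sqrf_eq0 => /eqP.
Qed.

Lemma cauchy_schwarz (x y : 'rV[R]_d) :
  `|\sum_(i < d) x 0 i * y 0 i| <= enorm x * enorm y.
Proof.
have [/enorm_eq0 ->|x0] := eqVneq (enorm x) 0.
  rewrite big1 ?normr0 ?mulr_ge0 ?enorm_ge0// => i _; by rewrite mxE mul0r.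
have [/enorm_eq0 ->|y0] := eqVneq (enorm y) 0.
  rewrite big1 ?normr0 ?mulr_ge0 ?enorm_ge0// => i _; by rewrite mxE mulr0.
(* The sums of squares of [enorm y x_i + c enorm x y_i], c = 1 and c = -1, give
   the two bounds. *)
have ab : 0 < 2 * (enorm x * enorm y).
  by rewrite !mulr_gt0// lt_neqAle eq_sym ?x0 ?y0 enorm_ge0.
have sqr_sum (c : R) : c ^+ 2 = 1 ->
    \sum_(i < d) (enorm y * x 0 i + c * enorm x * y 0 i) ^+ 2 =
    2 * (enorm x * enorm y) * (enorm x * enorm y + c * \sum_(i < d) x 0 i * y 0 i).
  move=> c1; rewrite [RHS](_ : _ = enorm y ^+ 2 * enorm x ^+ 2 +
    c ^+ 2 * enorm x ^+ 2 * enorm y ^+ 2 +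
    (2 * c * enorm x * enorm y) * \sum_(i < d) x 0 i * y 0 i); last first.
    rewrite c1; ring.
  rewrite [in X in _ * X + _ + _]enorm_sq [in X in _ + _ * X + _]enorm_sq.
  rewrite !mulr_sumr -!big_split /=; apply: eq_bigr => i _; ring.
have pos (c : R) : c ^+ 2 = 1 ->
    0 <= enorm x * enorm y + c * \sum_(i < d) x 0 i * y 0 i.
  move=> c1; rewrite -(pmulr_rge0 _ ab) -sqr_sum//.
  by apply: sumr_ge0 => i _; exact: sqr_ge0.
have := pos 1 (expr1n _ _); have := pos (-1); rewrite sqrrN expr1n => /(_ erefl).
rewrite ler_norml; set S := \sum_(i < d) _; move=> h1 h2; apply/andP; split; lra.
Qed.

(** A Lorentz map sends the closed causal cone of time orientation [e] into that
    of orientation [s * e], where [s] is the sign of the time component of the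
    image [A] of [time_unit].  The form of the image [U] of [z] with [A] is
    [- z.1]; by the Cauchy-Schwarz inequality it would have the opposite sign if
    [U], which is causal, had orientation [- s * e], as [A] is timelike. *)
Lemma lorentz_future (f : {linear ST -> ST}) (s e : R) z :
  lorentz f -> s ^+ 2 = 1 -> e ^+ 2 = 1 -> 0 < s * (f time_unit).1 ->
  enorm z.2 <= e * z.1 -> enorm (f z).2 <= s * e * (f z).1.
Proof.
move=> Lf s1 e1; set A := f time_unit; set U := f z => At0 cz.
have AA : s * A.1 * (s * A.1) = 1 + enorm A.2 ^+ 2.
  have := Lf time_unit time_unit.
  rewrite minkowski_time minkowski_diag /= -/A.
  move/eqP; rewrite addrC subr_eq => /eqP ->; nra.
have UU : U.1 ^+ 2 - enorm U.2 ^+ 2 = z.1 ^+ 2 - enorm z.2 ^+ 2.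
  have := Lf z z; rewrite !minkowski_diag -/U; lra.
have AU := Lf z time_unit; rewrite minkowski_time -/U -/A in AU.
have CS := cauchy_schwarz U.2 A.2.
have nA := enorm_ge0 A.2; have nU := enorm_ge0 U.2; have nz := enorm_ge0 z.2.
have At : enorm A.2 < s * A.1.
  rewrite -(@ltr_pXn2r _ 2)// ?nnegrE ?ltW//; nra.
have Ut2 : enorm U.2 ^+ 2 <= (s * e * U.1) ^+ 2.
  have : enorm z.2 ^+ 2 <= (e * z.1) ^+ 2.
    rewrite ler_pXn2r// nnegrE//; exact: le_trans cz.
  rewrite !exprMn s1 e1 !mul1r; lra.
have [Up|Un] := leP 0 (s * e * U.1).
  by rewrite -(@ler_pXn2r _ 2)// nnegrE.
exfalso; set u := - (s * e * U.1).
have u0 : 0 < u by rewrite oppr_gt0.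
have uU : enorm U.2 <= u.
  by rewrite -(@ler_pXn2r _ 2)// ?nnegrE ?(ltW u0)// /u sqrrN.
have aA : u * enorm A.2 < u * (s * A.1) by rewrite ltr_pM2l.
have UA : enorm U.2 * enorm A.2 <= u * enorm A.2 by rewrite ler_wpM2r.
have : e * z.1 = e * (U.1 * A.1 - \sum_(i < d) U.2 0 i * A.2 0 i).
  congr (_ * _); move: AU; rewrite /Defs.minkowski.
  by set S := \sum_(i < d) _; lra.
have -> : U.1 * A.1 = - e * (u * (s * A.1)).
  have -> : - e * (u * (s * A.1)) = s ^+ 2 * e ^+ 2 * (U.1 * A.1).
    by rewrite /u; ring.
  by rewrite s1 e1 !mul1r.
move: CS; set S := \sum_(i < d) _ => CS.
have -> : e * (- e * (u * (s * A.1)) - S) = - e ^+ 2 * (u * (s * A.1)) - e * S.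
  by ring.
rewrite e1 mulN1r.
have eS : `|e * S| <= enorm U.2 * enorm A.2.
  by rewrite normrM (_ : `|e| = 1) ?mul1r// -sqrtr_sqr e1 sqrtr1.
move: eS; rewrite ler_norml => /andP[eS _]; lra.
Qed.

End Lorentz.

(** * The extension of a Poincare transformation to the octagonal compactification *)

Section Extension.
Context {R : realType} {d : nat}.
Local Notation ST := (spacetime R d).
Local Notation eta := (@Defs.minkowski R d).
Implicit Types (z w v : ST) (p : ambientM R d) (q : ambientO R d).

(** The squared Euclidean norm, for which [MM] is half of the unit sphere. *)
Definition sqnorm p : R := p.1 ^+ 2 + p.2.1 ^+ 2 + enorm p.2.2 ^+ 2.
Definition nrm p : R := Num.sqrt (sqnorm p).

Lemma sqnorm_ge0 p : 0 <= sqnorm p.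
Proof. by rewrite !addr_ge0 ?sqr_ge0. Qed.

Lemma sqnormZ (c : R) p : sqnorm (c *: p) = c ^+ 2 * sqnorm p.
Proof. by rewrite /sqnorm /= enormZ !exprMn real_normK ?num_real// -!mulrDr. Qed.

Lemma nrmZ (c : R) p : 0 <= c -> nrm (c *: p) = c * nrm p.
Proof.
by move=> c0; rewrite /nrm sqnormZ sqrtrM ?sqr_ge0// sqrtr_sqr ger0_norm.
Qed.

Definition normalize p : ambientM R d := (nrm p)^-1 *: p.

Lemma normalizeZ (c : R) p : 0 < c -> normalize (c *: p) = normalize p.
Proof.
move=> c0; rewrite /normalize nrmZ ?ltW// scalerA invfM mulrAC mulVf ?mul1r//.
by rewrite gt_eqF.
Qed.

(** The point [z] of spacetime is the ray through [(1, z)]. *)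
Lemma toM_normalize z : toM z = normalize (1, z).
Proof.
rewrite /normalize /nrm /sqnorm /= expr1n; congr pair; exact: esym (mulr1 _).
Qed.

Lemma sqnorm_gt0 p : p != 0 -> 0 < sqnorm p.
Proof.
move=> p0; rewrite lt_neqAle sqnorm_ge0 andbT eq_sym; apply: contra p0.
rewrite /sqnorm !paddr_eq0 ?addr_ge0 ?sqr_ge0// !sqrf_eq0 => /andP[/andP[]].
case: p => [r [t x]] /= /eqP -> /eqP -> /eqP/enorm_eq0 ->.
by [].
Qed.

Lemma MM_sqnorm p : MM p <-> 0 <= p.1 /\ sqnorm p = 1.
Proof. by []. Qed.

Lemma coneE p : cone p = - eta p.2 p.2.
Proof. by rewrite minkowski_diag /cone; ring. Qed.

Lemma coneZ (c : R) p : cone (c *: p) = c ^+ 2 * cone p.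
Proof. by rewrite !coneE minkowskiZl minkowskiZr expr2 -mulrA !mulrN. Qed.

(** The map [z |-> L z + v] in homogeneous coordinates, where [(r, y)] with
    [0 < r] stands for [y / r]. *)
Definition hom_action (L : ST -> ST) v p : ambientM R d := (p.1, L p.2 + p.1 *: v).
Definition act_norm L v p : R := nrm (hom_action L v p).

(** The extension of [z |-> L z + v] to the radial compactification. *)
Definition actM L v p : ambientM R d := normalize (hom_action L v p).

(** With [rho p = sigma^2 a] and [cone p = sigma^2 b], the homogeneous action
    keeps [rho] and turns [cone] into [sigma^2 * shear]; see [cone_hom_action]. *)
Definition shear (L : ST -> ST) v q : R :=
  let: (p, (sigma, (a, b))) := q in
  b - 2 * a * eta (L p.2) v - sigma ^+ 2 * a ^+ 2 * eta v v.

(** [rho] and [cone] of the image, divided by [sigma^2]. *)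
Definition theta1 L v q : R := q.2.2.1 / act_norm L v q.1.
Definition theta2 L v q : R := shear L v q / act_norm L v q.1 ^+ 2.
Definition radius L v q : R := Num.sqrt (theta1 L v q ^+ 2 + theta2 L v q ^+ 2).

(** The extension of [z |-> L z + v] to the octagonal compactification.  The new
    [lambda = sigma^2] is the old one times [radius], hence the square root. *)
Definition actO L v q : ambientO R d :=
  let D := radius L v q in
  (actM L v q.1, (Num.sqrt D * q.2.1, (theta1 L v q / D, theta2 L v q / D))).

Lemma actME L v p : actM L v p = (act_norm L v p)^-1 *: hom_action L v p.
Proof. by []. Qed.

Lemma cone_hom_action (L : {linear ST -> ST}) v p : lorentz L ->
  cone (hom_action L v p) =
    cone p - 2 * p.1 * eta (L p.2) v - p.1 ^+ 2 * eta v v.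
Proof.
move=> LL; rewrite !coneE /hom_action /=.
rewrite minkowskiDl !minkowskiDr !minkowskiZl !minkowskiZr LL (minkowskiC v).
ring.
Qed.

Lemma act_norm_gt0 (L : {linear ST -> ST}) v p : injective L -> p != 0 ->
  0 < act_norm L v p.
Proof.
move=> Linj p0; rewrite sqrtr_gt0; apply: sqnorm_gt0; apply: contra p0.
move=> /eqP h; have r0 : p.1 = 0 := congr1 fst h.
have := congr1 snd h; rewrite /hom_action /= r0 scale0r addr0 => Lp0.
have y0 : p.2 = 0 by apply: Linj; rewrite Lp0 linear0.
by rewrite [p]surjective_pairing r0 y0.
Qed.

Lemma MM_neq0 p : MM p -> p != 0.
Proof.
move=> [_ /eqP]; apply: contraTneq => ->.
by rewrite -/(sqnorm _) -(scale0r (0 : ambientM R d)) sqnormZ expr0n mul0r eq_sym oner_eq0.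
Qed.

Lemma actM_MM (L : {linear ST -> ST}) v p : injective L -> MM p -> MM (actM L v p).
Proof.
move=> Linj Mp; have N0 := act_norm_gt0 v Linj (MM_neq0 Mp).
apply/MM_sqnorm; split.
  by case: Mp => p0 _; rewrite actME /= mulr_ge0// invr_ge0 ltW.
rewrite sqnormZ exprVn /act_norm /nrm sqr_sqrtr ?sqnorm_ge0// mulVf// gt_eqF//.
by move: N0; rewrite sqrtr_gt0.
Qed.

Lemma actM_toM (L : ST -> ST) v z :
  (forall c w, L (c *: w) = c *: L w) -> actM L v (toM z) = toM (L z + v).
Proof.
move=> Lsc.
rewrite (toM_normalize (_ + _)) -(normalizeZ (1, L z + v) (bdf_gt0 z)) /actM.
rewrite /hom_action /toM /= Lsc -scalerDr; congr (normalize (_, _)).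
by rewrite [RHS]mulr1.
Qed.

Lemma OO_MM q : OO q -> MM q.1.
Proof. by case: q => p [s [a b]] [_ []]. Qed.

Lemma shear_neq0 (L : ST -> ST) v q : OO q -> q.2.2.1 = 0 -> shear L v q != 0.
Proof.
case: q => p [s [a b]] [_ [_ _ /= [_ ab] _ _]] az.
rewrite az !(mulr0, mul0r) expr0n /= mulr0 mul0r !subr0.
apply: contra_eq_neq ab => ->.
by rewrite az expr0n addr0 eq_sym oner_eq0.
Qed.

Lemma radius_gt0 (L : {linear ST -> ST}) v q : injective L -> OO q ->
  0 < radius L v q.
Proof.
move=> Linj Oq; have N0 := act_norm_gt0 v Linj (MM_neq0 (OO_MM Oq)).
rewrite sqrtr_gt0 lt_neqAle addr_ge0 ?sqr_ge0// andbT eq_sym.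
rewrite paddr_eq0 ?sqr_ge0// !sqrf_eq0 /theta1 /theta2.
rewrite !mulf_eq0 !invr_eq0 expf_eq0 /= !(gt_eqF N0) !orbF.
by apply/negP => /andP[/eqP a0]; apply/negP; exact: shear_neq0.
Qed.

Lemma normalize_circle (x y r : R) : r != 0 -> r ^+ 2 = x ^+ 2 + y ^+ 2 ->
  (x / r) ^+ 2 + (y / r) ^+ 2 = 1.
Proof.
by move=> r0 rE; rewrite !expr_div_n -mulrDl -rE mulfV// expf_neq0.
Qed.

Lemma actO_OO (L : {linear ST -> ST}) v q : lorentz L -> injective L -> OO q -> OO (actO L v q).
Proof.
move=> LL Linj Oq; have D0 := radius_gt0 v Linj Oq.
case: q Oq D0 => p [s [a b]] [s0 [Mp _ /= [a0 ab] rp cp]] D0.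
have N0 := act_norm_gt0 v Linj (MM_neq0 Mp).
split; first by rewrite mulr_ge0// sqrtr_ge0.
set D := radius L v _ in D0 *.
have D2 : D ^+ 2 = theta1 L v (p, (s, (a, b))) ^+ 2 + theta2 L v (p, (s, (a, b))) ^+ 2.
  by rewrite sqr_sqrtr// addr_ge0 ?sqr_ge0.
have sD : Num.sqrt D ^+ 2 = D by rewrite sqr_sqrtr// ltW.
have Dn0 : D != 0 by rewrite gt_eqF.
have Nn0 : act_norm L v p != 0 by rewrite gt_eqF.
split => /=.
- exact: actM_MM.
- exact: sqr_ge0.
- split; first by rewrite !divr_ge0// ltW.
  exact: normalize_circle.
- rewrite exprMn sD -/(act_norm L v p) -[p.1]/(rho p) rp /theta1 /=.
  by rewrite /GRing.scale /=; field; rewrite Dn0.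
- rewrite exprMn sD actME coneZ cone_hom_action// cp -[p.1]/(rho p) rp /theta2 /=.
  by field; rewrite Dn0.
Qed.

(** The blowdown map is injective over the interior [0 < rho] of the radial
    compactification. *)
Lemma OO_inj q q' : OO q -> OO q' -> q.1 = q'.1 -> rho q.1 != 0 -> q = q'.
Proof.
case: q q' => p [s [a b]] [p' [s' [a' b']]] /= [s0 [_ _ [a0 ab] rp cp]].
move=> [s0' [_ _ [a0' ab'] rp' cp']] pp'; subst p'; move=> r0.
move: ab ab' a0 a0' rp rp' cp cp' => /= ab ab' a0 a0' rp rp' cp cp'.
have E : s ^+ 4 = rho p ^+ 2 + cone p ^+ 2.
  rewrite rp cp; transitivity (s ^+ 4 * (a ^+ 2 + b ^+ 2)); last by ring.
  by rewrite ab mulr1.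
have E' : s' ^+ 4 = rho p ^+ 2 + cone p ^+ 2.
  rewrite rp' cp'; transitivity (s' ^+ 4 * (a' ^+ 2 + b' ^+ 2)); last by ring.
  by rewrite ab' mulr1.
have ss : s = s' by apply/(@pexpIrn _ 4) => //; rewrite ?nnegrE// E E'.
have sn0 : s ^+ 2 != 0 by apply: contra_neq r0; rewrite rp => ->; rewrite mul0r.
by rewrite -ss; congr (_, (_, (_, _))); apply: (mulfI sn0); rewrite -?rp -?cp ?rp' ?cp' ss.
Qed.

Lemma actO_toO (L : {linear ST -> ST}) v z : lorentz L -> injective L ->
  actO L v (toO z) = toO (L z + v).
Proof.
move=> LL Linj.
have E : (actO L v (toO z)).1 = toM (L z + v).
  by apply: actM_toM => c w; rewrite linearZ.
apply: OO_inj.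
- by apply: actO_OO => //; exact: toO_OO.
- exact: toO_OO.
- exact: E.
- by rewrite E gt_eqF// bdf_gt0.
Qed.

(** The inverse of [z |-> L z + v] is [z |-> L' z - L' v].  Its homogeneous
    action takes the unit vector of [actM L v p] to [p / act_norm L v p]. *)
Lemma actMK (L L' : {linear ST -> ST}) v p : injective L -> cancel L L' ->
  MM p -> act_norm L' (- L' v) (actM L v p) = (act_norm L v p)^-1 /\
          actM L' (- L' v) (actM L v p) = p.
Proof.
move=> Linj LK Mp; have N0 := act_norm_gt0 v Linj (MM_neq0 Mp).
set N := act_norm L v p in N0 *.
have hE : hom_action L' (- L' v) (actM L v p) = N^-1 *: p.
  case: p @N N0 {Mp} => r y N N0; rewrite actME -/N /hom_action /=; congr pair.
  rewrite linearZ linearD linearZ /= LK scalerN -scalerA -scalerBr.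
  by rewrite addrK.
have nE : act_norm L' (- L' v) (actM L v p) = N^-1.
  rewrite {1}/act_norm hE nrmZ ?invr_ge0 ?ltW//.
  by rewrite /nrm (proj2 (proj1 (MM_sqnorm _) Mp)) sqrtr1 mulr1.
by split=> //; rewrite actME nE hE invrK scalerA mulfV ?scale1r// gt_eqF.
Qed.

Lemma actOK (L L' : {linear ST -> ST}) v q : lorentz L -> cancel L L' ->
  OO q -> actO L' (- L' v) (actO L v q) = q.
Proof.
move=> LL LK Oq; have Linj := can_inj LK.
have D0 := radius_gt0 v Linj Oq.
case: q Oq D0 => p [s [a b]] [s0 [Mp _ /= [a0 ab] rp cp]] D0.
have N0 := act_norm_gt0 v Linj (MM_neq0 Mp).
have [nE mE] := actMK v Linj LK Mp.
set q := (p, (s, (a, b))) in D0 *; set q' := actO L v q.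
set D := radius L v q in D0.
have sD : Num.sqrt D ^+ 2 = D by rewrite sqr_sqrtr// ltW.
have Dn0 : D != 0 by rewrite gt_eqF.
set N := act_norm L v p in N0 nE.
have Nn0 : N != 0 by rewrite gt_eqF.
have q1 : q'.1 = actM L v p by [].
have t1 : theta1 L' (- L' v) q' = a / D.
  by rewrite /theta1 q1 nE /= /theta1 /= -/N -/D; field; rewrite Dn0.
have sh : shear L' (- L' v) q' = b / (N ^+ 2 * D).
  rewrite /q' /actO /shear -/D exprMn sD /theta1 /theta2 /= -/N.
  have L'L : lorentz L'.
    by move=> z w; rewrite -LL !(cancel_linearC LK).
  rewrite -[- L' v]scaleN1r !minkowskiZr !minkowskiZl !L'L /= -/(act_norm L v p) -/N.
  rewrite minkowskiZl minkowskiDl minkowskiZl -[p.1]/(rho p) rp.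
  by field; rewrite Dn0.
have t2 : theta2 L' (- L' v) q' = b / D.
  by rewrite /theta2 q1 nE sh; field; rewrite Dn0.
have rE : radius L' (- L' v) q' = D^-1.
  rewrite /radius t1 t2 !expr_div_n -mulrDl ab mul1r -exprVn sqrtr_sqr.
  by rewrite gtr0_norm// invr_gt0.
rewrite {1}/actO rE t1 t2 q1 mE /= -/D invrK !divfK//; congr (_, (_, _)).
by rewrite mulrA -sqrtrM ?invr_ge0 ?(ltW D0)// mulVf// sqrtr1 mul1r.
Qed.

End Extension.

(** * Smoothness of the extension *)

Section Smoothness.
Context {R : realType} {d : nat}.
Local Notation ST := (spacetime R d).
Local Notation eta := (@Defs.minkowski R d).
Local Notation AO := (ambientO R d).
Context (L : {linear ST -> ST}) (v : ST).
Context {k : nat} {U : set AO} (oU : open U).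

Lemma Ck_rho : Ck k U (fun q : AO => q.1.1).
Proof. by do 2! apply: Ck_fst => //; exact: Ck_id. Qed.

Lemma Ck_tau : Ck k U (fun q : AO => q.1.2.1).
Proof. by apply: Ck_fst => //; apply: Ck_snd => //; apply: Ck_fst => //; exact: Ck_id. Qed.

Lemma Ck_xi i : Ck k U (fun q : AO => q.1.2.2 0 i).
Proof.
apply: Ck_coord => //; do 2! apply: Ck_snd => //; apply: Ck_fst => //; exact: Ck_id.
Qed.

Lemma Ck_sigma : Ck k U (fun q : AO => q.2.1).
Proof. by apply: Ck_fst => //; apply: Ck_snd => //; exact: Ck_id. Qed.

Lemma Ck_a : Ck k U (fun q : AO => q.2.2.1).
Proof. by apply: Ck_fst => //; do 2! apply: Ck_snd => //; exact: Ck_id. Qed.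

Lemma Ck_b : Ck k U (fun q : AO => q.2.2.2).
Proof. by do 3! apply: Ck_snd => //; exact: Ck_id. Qed.

(** A linear map is expanded in the basis of spacetime, which gives its
    smoothness without appeal to its continuity. *)
Lemma Ck_scaled_image (h : AO -> R) : Ck k U h ->
  Ck k U (fun q : AO => h q *: L q.1.2).
Proof.
move=> Ch.
have : Ck k U (fun q : AO => (h q * q.1.2.1) *: L (time_unit : ST) +
  \sum_(i < d) (h q * q.1.2.2 0 i) *: L (space_unit i)).
  apply: CkD => //; first by apply: CkZl => //; apply: CkM => //; exact: Ck_tau.
  by apply: Ck_sum => // i; apply: CkZl => //; apply: CkM => //; exact: Ck_xi.
apply: Ck_ext => // q _; rewrite (linear_spacetime L q.1.2).
rewrite !scalerDr scaler_sumr !scalerA; congr (_ + _).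
by apply: eq_bigr => i _; rewrite scalerA.
Qed.

Lemma Ck_scaled_action (h : AO -> R) : Ck k U h ->
  Ck k U (fun q : AO => h q *: (hom_action L v q.1).2).
Proof.
move=> Ch; have : Ck k U (fun q : AO => h q *: L q.1.2 + (h q * q.1.1) *: v).
  apply: CkD => //; first exact: Ck_scaled_image.
  by apply: CkZl => //; apply: CkM => //; exact: Ck_rho.
by apply: Ck_ext => // q _; rewrite scalerDr scalerA.
Qed.

Lemma Ck_minkowski (f : AO -> ST) w : Ck k U f -> Ck k U (fun q => eta (f q) w).
Proof.
move=> Cf; rewrite /Defs.minkowski; apply: CkD => //.
  apply: CkN => //; apply: CkM => //; last exact: Ck_cst.
  exact: Ck_fst.
apply: Ck_sum => // i; apply: CkM => //; last exact: Ck_cst.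
by apply: Ck_coord => //; exact: Ck_snd.
Qed.

Lemma Ck_sqnorm_action : Ck k U (fun q : AO => sqnorm (hom_action L v q.1)).
Proof.
have Cy : Ck k U (fun q : AO => (hom_action L v q.1).2).
  apply: Ck_ext (Ck_scaled_action (Ck_cst k U (1 : R))) => // q _.
  by rewrite scale1r.
apply: CkD => //.
  by apply: CkD => //; apply: Ck_sqr => //; [exact: Ck_rho | exact: Ck_fst].
apply: Ck_ext (_ : Ck k U (fun q => \sum_(i < d) (hom_action L v q.1).2.2 0 i ^+ 2)) => //.
  by move=> q _; rewrite enorm_sq.
by apply: Ck_sum => // i; apply: Ck_sqr => //; apply: Ck_coord => //; exact: Ck_snd.
Qed.

Lemma Ck_shear : Ck k U (shear L v).
Proof.
have Cy : Ck k U (fun q : AO => L q.1.2).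
  by apply: Ck_ext (Ck_scaled_image (Ck_cst k U (1 : R))) => // q _; rewrite scale1r.
suff : Ck k U (fun q : AO => q.2.2.2 - 2 * q.2.2.1 * eta (L q.1.2) v -
    q.2.1 ^+ 2 * q.2.2.1 ^+ 2 * eta v v) by apply: Ck_ext => // -[p [s [a b]]].
have Ca := Ck_a; have Cb := Ck_b; have Cs := Ck_sigma.
apply: CkD => //; first (apply: CkD => //; apply: CkN => //).
- by apply: CkM => //; [apply: CkM => //; exact: Ck_cst | exact: Ck_minkowski].
- apply: CkN => //; apply: CkM => //; last exact: Ck_cst.
  by apply: CkM => //; exact: Ck_sqr.
Qed.

(** Where the two hypotheses hold, the arguments of the square roots in [actO]
    are positive; the second is the positivity of [radius], free of quotients. *)
Lemma Ck_actO :
  (forall q, U q -> 0 < sqnorm (hom_action L v q.1)) ->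
  (forall q, U q ->
    0 < q.2.2.1 ^+ 2 * sqnorm (hom_action L v q.1) + shear L v q ^+ 2) ->
  Ck k U (actO L v).
Proof.
move=> U1 U2.
have CN : Ck k U (fun q => act_norm L v q.1) by apply: Ck_sqrt => //; exact: Ck_sqnorm_action.
have N0 q : U q -> 0 < act_norm L v q.1 by move=> Uq; rewrite sqrtr_gt0 U1.
have CNV : Ck k U (fun q => (act_norm L v q.1)^-1).
  by apply: CkV => // q Uq; rewrite gt_eqF// N0.
have Ct1 : Ck k U (theta1 L v) by apply: CkM => //; exact: Ck_a.
have Ct2 : Ck k U (theta2 L v).
  apply: CkM => //; first exact: Ck_shear.
  apply: CkV => //; last exact: Ck_sqr.
  by move=> q Uq; rewrite expf_neq0// gt_eqF// N0.
have pos q : U q -> 0 < theta1 L v q ^+ 2 + theta2 L v q ^+ 2.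
  move=> Uq; have Nq := N0 q Uq.
  have Ne : act_norm L v q.1 != 0 by rewrite gt_eqF.
  have -> : theta1 L v q ^+ 2 + theta2 L v q ^+ 2 =
    (q.2.2.1 ^+ 2 * act_norm L v q.1 ^+ 2 + shear L v q ^+ 2) / act_norm L v q.1 ^+ 4.
    by rewrite /theta1 /theta2; field.
  rewrite divr_gt0 ?exprn_gt0// {1}/act_norm /nrm sqr_sqrtr ?U2//.
  exact: sqnorm_ge0.
have Crad : Ck k U (radius L v).
  by apply: Ck_sqrt => //; apply: CkD => //; exact: Ck_sqr.
have r0 q : U q -> 0 < radius L v q by move=> Uq; rewrite sqrtr_gt0 pos.
have CrV : Ck k U (fun q => (radius L v q)^-1).
  by apply: CkV => // q Uq; rewrite gt_eqF// r0.
apply: Ck_pair => //.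
  apply: Ck_pair => //; last exact: Ck_scaled_action.
  by apply: CkM => //; exact: Ck_rho.
apply: Ck_pair => //.
  by apply: CkM => //; [apply: Ck_sqrt | exact: Ck_sigma].
by apply: Ck_pair => //; apply: CkM.
Qed.

End Smoothness.

Lemma smooth_actO (R : realType) (d : nat) (L : {linear spacetime R d -> spacetime R d}) v :
  injective L -> smooth_on OO (actO L v).
Proof.
move=> Linj q Oq.
pose n2 (q : ambientO R d) : R := sqnorm (hom_action L v q.1).
pose m2 (q : ambientO R d) : R := q.2.2.1 ^+ 2 * n2 q + shear L v q ^+ 2.
have oT := @openT (ambientO R d).
have Cn : continuous n2.
  have C1 : Ck 0%N setT n2 by exact: Ck_sqnorm_action.
  by move=> x; exact: C1.
have Cm : continuous m2.
  have C2 : Ck 0%N setT m2 := CkD oT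
    (CkM oT (Ck_sqr oT (Ck_a (k := 0) oT)) (Ck_sqnorm_action L v oT))
    (Ck_sqr oT (Ck_shear L v oT)).
  by move=> x; exact: C2.
exists ([set q | 0 < n2 q] `&` [set q | 0 < m2 q]), (actO L v); split=> //.
- by apply: openI; apply: open_comp (@open_gt _ 0) => x _; [exact: Cn | exact: Cm].
- have N0 : 0 < n2 q.
    by have := act_norm_gt0 v Linj (MM_neq0 (OO_MM Oq)); rewrite sqrtr_gt0.
  split => //=; have a2 := mulr_ge0 (sqr_ge0 q.2.2.1) (ltW N0).
  rewrite /m2 lt_neqAle (addr_ge0 a2 (sqr_ge0 _)) andbT eq_sym.
  rewrite paddr_eq0 ?sqr_ge0// mulf_eq0 !sqrf_eq0 (gt_eqF N0) orbF /=.
  by apply/negP => /andP[/eqP a0]; apply/negP; exact: shear_neq0.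
- move=> k; apply: Ck_actO => [|q' []|q' []]//.
  by apply: openI; apply: open_comp (@open_gt _ 0) => x _; [exact: Cn | exact: Cm].
Qed.

(** * The boundary faces *)

Section Faces.
Context {R : realType} {d : nat}.
Local Notation ST := (spacetime R d).

(** The boundary at infinity of a closed cone consists of its rays. *)
Lemma bd_clM_cone (C : set ST) : closed C ->
  (forall (c : R) z, 0 < c -> C z -> C (c *: z)) ->
  bdM `&` clM C = MM `&` [set p : ambientM R d | p.1 = 0 /\ C p.2].
Proof.
move=> clC CZ; apply/seteqP; split=> [p [[Mp p0] [_ clp]]|[r y] [Mp [/= r0 Cy]]].
  split=> //; split=> //.
  have : closed [set p : ambientM R d | C p.2].
    by apply: closed_comp clC => q _; exact: cvg_snd.
  move=> /closure_id E; suff : [set p : ambientM R d | C p.2] p by [].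
  rewrite E; apply: closureS clp => _ [z Cz <-] /=; apply: CZ => //.
  exact: bdf_gt0.
split=> //; split=> //; move: r0 Mp => -> Mp.
have sqn (s : R) : sqnorm (s, y) = s ^+ 2 + 1.
  by case: Mp => _; rewrite /sqnorm /= expr0n add0r -addrA => ->.
(* [g s] is the image under [toM] of [y / s], and tends to [(0, y)] at 0. *)
pose g (s : R) : ambientM R d := normalize (s, y).
have cg : {for 0, continuous g}.
  have cn : {for 0, continuous (fun s : R => (Num.sqrt (s ^+ 2 + 1))^-1)}.
    apply: cvgV; first by rewrite gt_eqF// sqrtr_gt0 expr0n add0r.
    apply: (@continuous_comp _ _ _ (fun s : R => s ^+ 2 + 1) Num.sqrt).
      by apply: cvgD; [exact: exprn_continuous | exact: cvg_cst].
    exact: sqrt_continuous.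
  have -> : g = (fun s => (Num.sqrt (s ^+ 2 + 1))^-1 *: ((s, y) : ambientM R d)).
    by apply/funext => s; rewrite /g /normalize /nrm sqn.
  have c1 : (s : R) @[s --> (0 : R)] --> (0 : R) by exact: cvg_id.
  have c2 : y @[s --> (0 : R)] --> y by exact: cvg_cst.
  by apply: cvgZ cn _; exact: cvg_pair c1 c2.
have g0 : g 0 = (0, y).
  by rewrite /g /normalize /nrm sqn expr0n add0r sqrtr1 invr1 scale1r.
rewrite -g0.
have cu : g (harmonic n) @[n --> \oo] --> g 0.
  by apply: (cvg_comp _ _ (@cvg_harmonic R)); exact: cg.
apply: (closed_cvg _ (@closed_closure _ _) _ _ cu); apply: nearW => n.
have h0 : 0 < harmonic n :> R := harmonic_gt0 n.
apply: subset_closure; exists ((harmonic n)^-1 *: y) => /=.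
  by apply: CZ => //; rewrite invr_gt0.
rewrite toM_normalize -(normalizeZ _ h0); congr (normalize (_, _)).
  exact: mulr1.
by rewrite scalerA mulfV ?scale1r// gt_eqF.
Qed.

Lemma continuous_enorm_snd : continuous (fun z : ST => enorm z.2).
Proof.
move=> z; apply: (@continuous_comp _ _ _ (fun z : ST => z.2) (@enorm R d)).
  exact: cvg_snd.
exact: continuous_enorm.
Qed.

Lemma causal_bdE (e : R) : causal_bd e =
  MM `&` [set p : ambientM R d | p.1 = 0 /\ enorm p.2.2 <= e * p.2.1].
Proof.
rewrite /causal_bd bd_clM_cone//.
  have -> : [set z : ST | enorm z.2 <= e * z.1] =
     (fun z : ST => e * z.1 - enorm z.2) @^-1` [set r | 0 <= r].
    by apply/seteqP; split=> z /=; rewrite subr_ge0.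
  apply: closed_comp (@closed_ge _ 0) => z _.
  apply: cvgB; last exact: continuous_enorm_snd.
  by apply: cvgMl_tmp; exact: cvg_fst.
by move=> c z c0 /=; rewrite enormZ gtr0_norm// mulrCA ler_pM2l.
Qed.

Lemma spacelike_bdE : spacelike_bd =
  MM `&` [set p : ambientM R d | p.1 = 0 /\ p.2.1 ^+ 2 <= enorm p.2.2 ^+ 2].
Proof.
rewrite /spacelike_bd bd_clM_cone//.
  have -> : [set z : ST | z.1 ^+ 2 <= enorm z.2 ^+ 2] =
     (fun z : ST => enorm z.2 ^+ 2 - z.1 ^+ 2) @^-1` [set r | 0 <= r].
    by apply/seteqP; split=> z /=; rewrite subr_ge0.
  apply: closed_comp (@closed_ge _ 0) => z _; apply: cvgB.
    apply: (@continuous_comp _ _ _ (fun z : ST => enorm z.2) (fun r => r ^+ 2)).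
      exact: continuous_enorm_snd.
    exact: exprn_continuous.
  apply: (@continuous_comp _ _ _ (fun z : ST => z.1) (fun r => r ^+ 2)).
    exact: cvg_fst.
  exact: exprn_continuous.
move=> c z c0 /=; rewrite enormZ exprMn exprMn real_normK ?num_real//.
by rewrite ler_pM2l// exprn_gt0.
Qed.

Section Action.
Context (L : {linear ST -> ST}) (v : ST) (LL : lorentz L) (Linj : injective L).

Lemma actM_bd p : MM p -> p.1 = 0 ->
  exists2 c : R, 0 < c & actM L v p = (0, c *: L p.2).
Proof.
move=> Mp p0; exists (act_norm L v p)^-1.
  by rewrite invr_gt0 act_norm_gt0// MM_neq0.
rewrite /actM /normalize -/(act_norm L v p) /hom_action p0 scale0r addr0.
by congr pair; rewrite /= [LHS]mulr0.
Qed.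

Lemma scri_actM p : MM p -> scri (actM L v p) -> scri p.
Proof.
rewrite !scriE => Mp [_ [r c]]; have N0 := act_norm_gt0 v Linj (MM_neq0 Mp).
have p0 : p.1 = 0.
  move/eqP: r; rewrite /rho /actM /= [_ *: _]mulrC mulf_eq0 invr_eq0 => /orP[/eqP//|].
  by rewrite (gt_eqF N0).
split=> //; split=> //; move/eqP: c.
rewrite coneZ cone_hom_action// p0 expr0n /= !(mulr0, mul0r) !subr0.
by rewrite mulf_eq0 expf_eq0 /= invr_eq0 (gt_eqF N0) => /eqP.
Qed.

(** By continuity of [actO], the lift of a face is mapped where its image in the
    radial compactification is. *)
Lemma lift_actO (F F' : set (ambientM R d)) :
  (forall p, MM p -> F p -> F' (actM L v p)) ->
  forall q, Defs.lift F q -> Defs.lift F' (actO L v q).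
Proof.
move=> FF' q [Oq clq]; split; first exact: actO_OO.
have [U [G [oU Uq CG GE]]] := smooth_actO v Linj Oq.
have cG : {for q, continuous G} := CG 0%N q Uq.
rewrite -(GE q Oq Uq) => B nB.
have nUB : nbhs q (U `&` G @^-1` B).
  by apply: filterI; [exact: open_nbhs_nbhs | exact: cG].
have [x [SOx UBx]] := clq _ nUB.
have [Ox [Fx sx]] := SOx.
have [Ux Bx] := UBx.
exists (G x); split=> //.
rewrite GE//; split; first exact: actO_OO.
have Mx : MM x.1 := OO_MM Ox.
by split; [exact: FF' | move=> /scri_actM; apply: contra_not sx; exact].
Qed.

Lemma lift_spacelike q : Defs.lift spacelike_bd q -> Defs.lift spacelike_bd (actO L v q).
Proof.
apply: lift_actO => p Mp; rewrite !spacelike_bdE => -[_ [p0 cp]].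
split; first exact: actM_MM.
have [c c0 ->] := actM_bd Mp p0; split=> //=.
have := LL p.2 p.2; rewrite !minkowski_diag => E.
rewrite enormZ exprMn exprMn real_normK ?num_real// ler_pM2l ?exprn_gt0//.
by move: E cp; lra.
Qed.

Context (s : R) (s2 : s ^+ 2 = 1) (s0 : 0 < s * (L (time_unit : ST)).1).

Lemma lift_causal (e : R) q : e ^+ 2 = 1 ->
  Defs.lift (causal_bd e) q -> Defs.lift (causal_bd (s * e)) (actO L v q).
Proof.
move=> e2; apply: lift_actO => p Mp; rewrite !causal_bdE => -[_ [p0 cp]].
split; first exact: actM_MM.
have [c c0 ->] := actM_bd Mp p0; split=> //=.
rewrite enormZ gtr0_norm// mulrCA ler_pM2l//.
exact: (lorentz_future LL s2 e2 s0).
Qed.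

Lemma front_actO (e : R) q : e ^+ 2 = 1 ->
  (OO `&` @blowdown R d @^-1` (scri_ e)) q ->
  (OO `&` @blowdown R d @^-1` (scri_ (s * e))) (actO L v q).
Proof.
move=> e2 [Oq /= sq]; split; first exact: actO_OO.
move: sq; rewrite /= /blowdown !scri_E => -[Mp [r0 cp]].
split; first exact: actM_MM.
have [c c0 ->] := actM_bd Mp r0; split=> //=.
have fz : enorm (L q.1.2).2 <= s * e * (L q.1.2).1.
  by apply: lorentz_future => //; rewrite cp.
have := LL q.1.2 q.1.2; rewrite !minkowski_diag => E.
rewrite enormZ gtr0_norm// mulrCA; congr (_ * _).
have fz0 : 0 <= s * e * (L q.1.2).1 := le_trans (enorm_ge0 _) fz.
apply: (@pexpIrn _ 2) => //; rewrite ?nnegrE ?enorm_ge0//.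
rewrite !exprMn s2 e2 !mul1r.
have : enorm q.1.2.2 ^+ 2 = q.1.2.1 ^+ 2 by rewrite -cp exprMn e2 mul1r.
by move: E; lra.
Qed.

End Action.

Section Image.
Context (L : {linear ST -> ST}) (v : ST) (LL : lorentz L).

(* The inverse transformation is [z |-> L' z + v']. *)
Let L' := adjoint L.
Let v' := - L' v.

Lemma actOKV q : OO q -> actO L v (actO L' v' q) = q.
Proof.
move=> Oq; have -> : v = - L v' by rewrite linearN /L' adjointVK// opprK.
by apply: actOK => //; [exact: lorentz_adjoint | exact: adjointVK].
Qed.

Lemma actO_image (X Y : set (ambientO R d)) : Y `<=` OO ->
  (forall q, X q -> Y (actO L v q)) -> (forall q, Y q -> X (actO L' v' q)) ->
  actO L v @` X = Y.
Proof.
move=> YO XY YX; apply/seteqP; split=> [_ [q Xq <-]|q Yq]; first exact: XY.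
by exists (actO L' v' q); [exact: YX | apply: actOKV; exact: YO].
Qed.

Lemma diffeomorphism_actO : diffeomorphism OO OO (actO L v).
Proof.
have LK := adjointK LL; have LVK := adjointVK LL.
exists (actO L' v'); split.
- by split=> q Oq; apply: actO_OO => //; [exact: can_inj LK | exact: lorentz_adjoint | exact: can_inj LVK].
- by move=> q Oq; exact: actOK.
- exact: actOKV.
- exact/smooth_actO/(can_inj LK).
- exact/smooth_actO/(can_inj LVK).
Qed.

Lemma faces_actO (s : R) : s ^+ 2 = 1 -> 0 < s * (L (time_unit : ST)).1 ->
  (forall e, e ^+ 2 = 1 ->
    actO L v @` Defs.lift (causal_bd e) = Defs.lift (causal_bd (s * e)) /\
    actO L v @` (OO `&` @blowdown R d @^-1` (scri_ e)) =
      OO `&` @blowdown R d @^-1` (scri_ (s * e))) /\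
  actO L v @` Defs.lift spacelike_bd = Defs.lift spacelike_bd.
Proof.
move=> s2 s0; have Linj := can_inj (adjointK LL).
have L'inj := can_inj (adjointVK LL); have LL' := lorentz_adjoint LL.
have s0' : 0 < s * (L' (time_unit : ST)).1.
  by rewrite -[_.1]opprK -minkowski_time minkowski_adjoint minkowskiC minkowski_time opprK.
split=> [e e2|].
  have se2 : (s * e) ^+ 2 = 1 by rewrite exprMn s2 e2 mulr1.
  have sse : s * (s * e) = e by rewrite mulrA -expr2 s2 mul1r.
  split; apply: actO_image => [q []//|q|q].
  - exact: lift_causal.
  - by rewrite -[in X in _ -> X]sse; exact: lift_causal.
  - exact: front_actO.
  - by rewrite -[in X in _ -> X]sse; exact: front_actO.
apply: actO_image => [q []//|q|q]; exact: lift_spacelike.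
Qed.

End Image.

Lemma lorentz_time_neq0 (L : {linear ST -> ST}) : lorentz L ->
  (L (time_unit : ST)).1 != 0.
Proof.
move=> LL; have := LL time_unit time_unit.
rewrite minkowski_time minkowski_diag /= => E; apply/eqP => t0.
by move: E; rewrite t0 expr0n /= oppr0 add0r; have := sqr_ge0 (enorm (L time_unit).2); lra.
Qed.

End Faces.

Theorem proposition2p1 (R : realType) (d : nat)
    (Lam : spacetime R d -> spacetime R d) :
  (1 <= d)%N -> poincare Lam ->
  exists Phi : ambientO R d -> ambientO R d,
    [/\ diffeomorphism OO OO Phi,
        forall z, Phi (toO z) = toO (Lam z),
        orthochronous Lam ->
          [/\ Phi @` Pf = Pf,
              Phi @` nPf = nPf,
              Phi @` Sf = Sf,
              Phi @` nFf = nFf &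
              Phi @` Ff = Ff] &
        ~ orthochronous Lam ->
          [/\ Phi @` Pf = Ff,
              Phi @` nPf = nFf,
              Phi @` Sf = Sf,
              Phi @` nFf = nPf &
              Phi @` Ff = Pf]].
Proof.
move=> _ [L [v [LamE LL]]]; exists (actO L v).
have orthoE : orthochronous Lam <-> 0 < (L (time_unit : spacetime R d)).1.
  by rewrite /orthochronous !LamE linear0 add0r /= addrK.
have e1 : (1 : R) ^+ 2 = 1 by exact: expr1n.
have eN1 : (-1 : R) ^+ 2 = 1 by rewrite sqrrN.
split.
- exact: diffeomorphism_actO.
- by move=> z; rewrite LamE; apply: actO_toO => //; exact: can_inj (adjointK LL).
- move=> /orthoE t0; have [] := faces_actO v LL e1; first by rewrite mul1r.
  move=> H S; have [F1 n1] := H _ e1; have [F2 n2] := H _ eN1.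
  by move: F1 n1 F2 n2; rewrite !mul1r; split.
- move=> /orthoE/negP; rewrite -leNgt le_eqVlt (negbTE (lorentz_time_neq0 LL)) /= => t0.
  have [] := faces_actO v LL eN1; first by rewrite mulN1r oppr_gt0.
  move=> H S; have [F1 n1] := H _ e1; have [F2 n2] := H _ eN1.
  by move: F1 n1 F2 n2; rewrite mulr1 mulrNN mulr1; split.
Qed.
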